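(* Let $n\ge 0$ be an integer, let $r, w_1, w_2\in\mathbb{N}$, let $q\in\mathbb{C}_p$ with $q\neq 1$ and $|1-q|_p<p^{-1/(p-1)}$, and let $x\in\mathbb{C}_p$ with $|x|_p\le 1$. Then $$[w_1]_q^{n-r}\sum_{j_1,\dots,j_r=0}^{w_1-1}q^{w_2(j_1+\cdots+j_r)}\beta_{n,q^{w_1}}^{(r)}\left(w_2x+\frac{w_2}{w_1}(j_1+\cdots+j_r)\right)$$ $$=[w_2]_q^{n-r}\sum_{j_1,\dots,j_r=0}^{w_2-1}q^{w_1(j_1+\cdots+j_r)}\beta_{n,q^{w_2}}^{(r)}\left(w_1x+\frac{w_1}{w_2}(j_1+\cdots+j_r)\right).$$
   Context: $p$ is a fixed prime; $\mathbb{C}_p$ is the completion of an algebraic closure of $\mathbb{Q}_p$, with absolute value normalized by $|p|_p=p^{-1}$. $\mathbb{N}=\{1,2,3,\dots\}$. For $Q\in\mathbb{C}_p$ with $Q\ne 1$, $|1-Q|_p<p^{-1/(p-1)}$ and $z\in\mathbb{C}_p$ with $|z\log Q|_p<p^{-1/(p-1)}$, put $Q^z=\exp(z\log Q)$ ($p$-adic exponential and logarithm) and $[z]_Q=\frac{1-Q^z}{1-Q}$. If $q$ satisfies $q\ne1$, $|1-q|_p<p^{-1/(p-1)}$, then so does $q^{w}$ for every $w\in\mathbb{N}$. Since $\log(q^{w})=w\log q$, the expression $(q^{w})^z=q^{wz}$ is defined whenever $|wz|_p\le1$; in particular $(q^{w_1})^{\frac{w_2}{w_1}j}=q^{w_2j}$.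 The higher-order Carlitz $Q$-Bernoulli polynomials (order $r\in\mathbb{N}$, $n\ge0$) are $$\beta_{n,Q}^{(r)}(z)=\frac{1}{(1-Q)^n}\sum_{l=0}^{n}\binom{n}{l}(-1)^lQ^{lz}\left(\frac{l+1}{[l+1]_Q}\right)^r .$$ *)

(* Defs.v *)
From HB Require Import structures.
From mathcomp Require Import all_boot all_order all_algebra.
From mathcomp Require Import all_classical all_reals all_analysis.

Set Implicit Arguments.
Unset Strict Implicit.
Unset Printing Implicit Defensive.

Import Order.TTheory GRing.Theory Num.Theory.
Import numFieldNormedType.Exports.

Local Open Scope classical_set_scope.
Local Open Scope ring_scope.

(* Absolute values are explicit functions [v : K -> R]: the norm of MathComp's
   [normedZmodType] satisfies |x *+ n| = |x| *+ n, which excludes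
   non-archimedean absolute values. *)
Definition is_nonarch_abs (R : realType) (K : fieldType) (v : K -> R) : Prop :=
  [/\ forall x, 0 <= v x,
      forall x, v x = 0 <-> x = 0,
      forall x y, v (x * y) = v x * v y
    & forall x y, v (x + y) <= Num.max (v x) (v y)].

Definition abs_cvg (R : realType) (K : fieldType) (v : K -> R)
    (u : nat -> K) (l : K) : Prop :=
  (fun n => v (u n - l)) @ \oo --> (0 : R).

Definition abs_cauchy (R : realType) (K : fieldType) (v : K -> R)
    (u : nat -> K) : Prop :=
  forall e : R, 0 < e -> exists N : nat, forall m n : nat,
    (N <= m)%N -> (N <= n)%N -> v (u m - u n) < e.

Definition abs_complete (R : realType) (K : fieldType) (v : K -> R) : Prop :=
  forall u : nat -> K, abs_cauchy v u -> exists l, abs_cvg v u l.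

(* [0] when there is no limit. *)
Definition abs_lim (R : realType) (K : fieldType) (v : K -> R)
    (u : nat -> K) : K :=
  xget 0 [set l | abs_cvg v u l].

Definition is_completion (R : realType) (K L : fieldType)
    (vK : K -> R) (vL : L -> R) (i : {rmorphism K -> L}) : Prop :=
  [/\ is_nonarch_abs vL,
      forall a, vL (i a) = vK a,
      forall (y : L) (e : R), 0 < e -> exists a, vL (y - i a) < e
    & abs_complete vL].

Definition is_algebraic_closure (K L : fieldType) (i : {rmorphism K -> L}) :
    Prop :=
  GRing.closed_field_axiom L /\ forall y : L, algebraicOver i y.

(* |a/b| = p ^ (v_p(b) - v_p(a)). *)
Definition padic_abs_rat (R : realType) (p : nat) (a : rat) : R :=
  if a == 0 then 0
  else p%:R ^ ((logn p `|denq a|%N)%:Z - (logn p `|numq a|%N)%:Z).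

(* [(C, v)] is a completion of an algebraic closure [Qpbar] of a completion
   [Qp] of the rationals; this determines [(C, v)] up to isometric
   isomorphism. *)
Definition is_Cp (R : realType) (p : nat) (C : fieldType) (v : C -> R) : Prop :=
  exists (Qp : fieldType) (vp : Qp -> R) (i : {rmorphism rat -> Qp})
         (Qpbar : fieldType) (vbar : Qpbar -> R) (j : {rmorphism Qp -> Qpbar})
         (k : {rmorphism Qpbar -> C}),
    [/\ is_completion (@padic_abs_rat R p) vp i,
        is_algebraic_closure j,
        is_nonarch_abs vbar,
        forall a, vbar (j a) = vp a
      & is_completion vbar v k].

(* The bound p ^ (-1/(p-1)). *)
Definition padic_radius (R : realType) (p : nat) : R :=
  p%:R `^ (- (p%:R - 1)^-1).

Definition padic_exp (R : realType) (C : fieldType) (v : C -> R) (x : C) : C :=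
  abs_lim v (series (fun k : nat => x ^+ k / k`!%:R)).

Definition padic_log (R : realType) (C : fieldType) (v : C -> R) (Q : C) : C :=
  abs_lim v (series (fun k : nat => (-1) ^+ k * (Q - 1) ^+ k.+1 / k.+1%:R)).

Definition padic_pow (R : realType) (C : fieldType) (v : C -> R) (Q z : C) : C :=
  padic_exp v (z * padic_log v Q).

Definition qbracket (R : realType) (C : fieldType) (v : C -> R) (Q z : C) : C :=
  (1 - padic_pow v Q z) / (1 - Q).

Definition carlitz_bernoulli (R : realType) (C : fieldType) (v : C -> R)
    (r n : nat) (Q z : C) : C :=
  ((1 - Q) ^+ n)^-1 *
  \sum_(0 <= l < n.+1)
     'C(n, l)%:R * (-1) ^+ l * padic_pow v Q (l%:R * z) *
     (l.+1%:R / qbracket v Q l.+1%:R) ^+ r.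

(* Main.v *)
Require Import Defs.
From HB Require Import structures.
From mathcomp Require Import all_boot all_order all_algebra.
From mathcomp Require Import all_classical all_reals all_analysis.
From mathcomp Require Import ring zify.

Set Implicit Arguments.
Unset Strict Implicit.
Unset Printing Implicit Defensive.

Import Order.TTheory GRing.Theory Num.Theory.

Local Open Scope ring_scope.

(** Put L = log q.  Once exp L = q is known, everything on the left-hand side
is a power of q, except for the factor exp (l w1 w2 x L) in the l-th term of
the Bernoulli polynomial.  The sum over the j's of q^(w2 (l+1) (j_1+...+j_r))
is the r-th power of a geometric sum, and after cancellation the left-hand
side becomes
<<
  (1-q)^(r-n) * sum_l C(n,l) (-1)^l exp (l w1 w2 x L)
     * ((l+1) (1 - q^(w1 w2 (l+1)))
          / ((1 - q^(w1 (l+1))) (1 - q^(w2 (l+1)))))^r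
>>
which is symmetric in w1 and w2; this is [qbracket_sum_carlitz].

What remains is the p-adic analysis on the discs |x| < rho and |q - 1| < rho
with rho = p^(-1/(p-1)): exp is additive, log is a homomorphism, exp and log
are inverse to each other, and q^m <> 1 for m > 0.  The arithmetic input is
|p| < 1 and Legendre's bound (p-1) v_p((m+1)!) <= m, in the form
rho^m <= |(m+1)!|, which gives geometric decay of both series.

Formally composing the two power series is avoided by describing the
logarithm as a derivative of powers at 0:
<<
  |log q - (q^N - 1)/N| <= |N| |q - 1|   for N > 0  ([pow_log_approx]).
>>
It follows by comparing the series of log with the binomial expansion of
q^N, since (N-1)(N-2)...(N-k) is congruent to (-1)^k k! modulo N.  Letting N
run through the powers of p, any y with |y - (q^N - 1)/N| <= |N| for all N > 0
equals log q ([padic_log_unique]).  This yields log (a b) = log a + log b and,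
from exp y ^ N = exp (N y), also log (exp y) = y.  The first-order estimate
|log q - (q - 1)| < |q - 1| for q <> 1 makes log injective, so that
exp (log q) = q. *)

(** * Non-archimedean absolute values *)

Section NonarchimedeanAbsoluteValue.
Import numFieldNormedType.Exports.
Local Open Scope classical_set_scope.
Local Open Scope ring_scope.

Variables (R : realType) (K : fieldType) (v : K -> R).
Hypothesis hv : is_nonarch_abs v.

Lemma abs_ge0 x : 0 <= v x. Proof. by case: hv. Qed.

Lemma absM x y : v (x * y) = v x * v y. Proof. by case: hv. Qed.

Lemma abs_eq0 x : (v x == 0) = (x == 0).
Proof. by case: hv => _ h _ _; apply/eqP/eqP => /h. Qed.

Lemma abs0 : v 0 = 0. Proof. by apply/eqP; rewrite abs_eq0. Qed.

Lemma abs_gt0 x : (0 < v x) = (x != 0).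
Proof. by rewrite lt_def abs_eq0 abs_ge0 andbT. Qed.

Lemma abs_leD B x y : v x <= B -> v y <= B -> v (x + y) <= B.
Proof.
by case: hv => _ _ _ h hx hy; rewrite (le_trans (h _ _))// ge_max hx hy.
Qed.

Lemma abs_ltD B x y : v x < B -> v y < B -> v (x + y) < B.
Proof.
by case: hv => _ _ _ h hx hy; rewrite (le_lt_trans (h _ _))// gt_max hx hy.
Qed.

Lemma abs1 : v 1 = 1.
Proof.
have v1 : v 1 != 0 by rewrite abs_eq0 oner_eq0.
by apply: (mulIf v1); rewrite -absM !mul1r.
Qed.

Lemma absN x : v (- x) = v x.
Proof.
suff vN1 : v (-1) = 1 by rewrite -mulN1r absM vN1 mul1r.
apply/eqP; rewrite -(@pexpr_eq1 _ _ 2) ?abs_ge0//.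
by rewrite expr2 -absM mulrNN mulr1 abs1.
Qed.

Lemma abs_leB B x y : v x <= B -> v y <= B -> v (x - y) <= B.
Proof. by move=> hx hy; apply: abs_leD => //; rewrite absN. Qed.

Lemma abs_subC x y : v (x - y) = v (y - x).
Proof. by rewrite -absN opprB. Qed.

Lemma absX x n : v (x ^+ n) = v x ^+ n.
Proof. by elim: n => [|n IH]; rewrite ?expr0 ?abs1// !exprS absM IH. Qed.

Lemma abs_div x y : v (x / y) = v x / v y.
Proof.
have [->|y0] := eqVneq y 0; first by rewrite invr0 mulr0 abs0 invr0 mulr0.
have vy0 : v y != 0 by rewrite abs_eq0.
by apply: (mulIf vy0); rewrite -absM !divfK.
Qed.

Lemma abs_sign n : v ((-1) ^+ n) = 1.
Proof. by rewrite absX absN abs1 expr1n. Qed.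

Lemma abs_nat_le1 n : v n%:R <= 1.
Proof.
elim: n => [|n IH]; first by rewrite abs0.
by rewrite -natr1; apply: abs_leD; rewrite ?abs1.
Qed.

Lemma abs_sum_le (I : Type) (s : seq I) (P : pred I) (F : I -> K) B :
  0 <= B -> (forall i, P i -> v (F i) <= B) -> v (\sum_(i <- s | P i) F i) <= B.
Proof.
move=> B0 h; elim/big_rec: _ => [|i x Pi IH]; first by rewrite abs0.
by apply: abs_leD; rewrite ?h.
Qed.

Lemma abs_sum_nat_le m n (F : nat -> K) B :
  0 <= B -> (forall i, (m <= i < n)%N -> v (F i) <= B) ->
  v (\sum_(m <= i < n) F i) <= B.
Proof. by move=> B0 h; rewrite big_nat; apply: abs_sum_le. Qed.

Lemma abs_le_triangle x y : v (x + y) <= v x + v y.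
Proof.
case: hv => _ _ _ h; rewrite (le_trans (h _ _))// ge_max.
by rewrite lerDl lerDr !abs_ge0.
Qed.

Lemma abs_cvgP u l : abs_cvg v u l <->
  forall e : R, 0 < e -> exists N : nat, forall n, (N <= n)%N -> v (u n - l) < e.
Proof.
split=> [/cvgr0Pnorm_lt h e e0|h].
  have [N _ hN] := h _ e0; exists N => n Nn.
  by have := hN n Nn; rewrite /= ger0_norm ?abs_ge0.
apply/cvgr0Pnorm_lt => e e0; have [N hN] := h _ e0.
by exists N => // n /= Nn; rewrite ger0_norm ?abs_ge0// hN.
Qed.

Lemma abs_cvg_near u l : abs_cvg v u l ->
  forall e : R, 0 < e -> forall m, exists2 n, (m <= n)%N & v (u n - l) < e.
Proof.
move=> /abs_cvgP ul e e0 m; have [N hN] := ul _ e0.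
by exists (maxn m N); rewrite ?leq_maxl// hN// leq_maxr.
Qed.

Lemma abs_cvg_dist_le u l c B m : abs_cvg v u l -> 0 <= B ->
  (forall n, (m <= n)%N -> v (u n - c) <= B) -> v (l - c) <= B.
Proof.
move=> ul B0 h; apply/ler_addgt0Pr => e e0.
have [n mn hn] := abs_cvg_near ul e0 m.
rewrite -(subrKA (u n)) addrC; apply: abs_leD.
  by rewrite (le_trans (h _ mn))// lerDl ltW.
by rewrite abs_subC (le_trans (ltW hn))// lerDr.
Qed.

Lemma abs_cvg_unique u l l' : abs_cvg v u l -> abs_cvg v u l' -> l = l'.
Proof.
move=> ul ul'; apply/eqP; rewrite -subr_eq0 -abs_eq0 eq_le abs_ge0 andbT.
apply/ler_addgt0Pr => e e0; rewrite add0r.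
have /abs_cvgP/(_ _ e0)[m hm] := ul'.
by apply: (abs_cvg_dist_le ul (ltW e0)) => n /hm/ltW; exact.
Qed.

Lemma abs_limE u l : abs_cvg v u l -> abs_lim v u = l.
Proof.
by move=> ul; apply: xget_unique => // l' ul'; apply: abs_cvg_unique ul' ul.
Qed.

Lemma abs_cvgM u w l m : abs_cvg v u l -> abs_cvg v w m ->
  abs_cvg v (fun n => u n * w n) (l * m).
Proof.
move=> ul wm; rewrite /abs_cvg.
have lim0 : (fun n => v (u n - l) * v (w n - m) +
    (v (u n - l) * v m + v l * v (w n - m))) @ \oo --> (0 : R).
  rewrite -[X in _ --> X](_ : 0 * 0 + (0 * v m + v l * 0) = 0); last by ring.
  apply: cvgD; first exact: cvgM.
  by apply: cvgD; [apply: cvgMl|apply: cvgMr].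
apply: (squeeze_cvgr _ (cvg_cst 0) lim0); near=> n.
rewrite abs_ge0 /= -!absM.
have -> : u n * w n - l * m =
    (u n - l) * (w n - m) + ((u n - l) * m + l * (w n - m)) by ring.
by rewrite (le_trans (abs_le_triangle _ _))// lerD2l abs_le_triangle.
Unshelve. all: by end_near. Qed.

Lemma abs_cvg_close u w l (B : nat -> R) : abs_cvg v u l ->
  B @ \oo --> (0 : R) -> (forall n, v (w n - u n) <= B n) -> abs_cvg v w l.
Proof.
move=> ul B0 h; rewrite /abs_cvg.
have lim0 : (fun n => B n + v (u n - l)) @ \oo --> (0 : R).
  by rewrite -[X in _ --> X](addr0 0); apply: cvgD.
apply: (squeeze_cvgr _ (cvg_cst 0) lim0); near=> n.
rewrite abs_ge0 /= -(subrKA (u n)) (le_trans (abs_le_triangle _ _))//.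
by rewrite lerD2r h.
Unshelve. all: by end_near. Qed.

Hypothesis hcomplete : abs_complete v.

Lemma abs_series_cvg (a : nat -> K) (c d : R) : 0 <= c -> 0 <= d < 1 ->
  (forall k, v (a k) <= c * d ^+ k) ->
  abs_cvg v (series a) (abs_lim v (series a)).
Proof.
move=> c0 /andP[d0 d1] ha; suff [l hl] : exists l, abs_cvg v (series a) l.
  by rewrite (abs_limE hl).
apply: hcomplete => e e0.
have : geometric c d @ \oo --> (0 : R).
  by apply: cvg_geometric; rewrite ger0_norm.
move=> /cvgr0Pnorm_lt/(_ _ e0)[N _ hN]; exists N.
have tail m n : (N <= m <= n)%N -> v (series a n - series a m) < e.
  move=> /andP[Nm mn]; rewrite /series/= (@big_cat_nat _ _ _ m 0 n)//=.
  rewrite addrAC subrr add0r.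
  have := hN m Nm; rewrite /geometric/= ger0_norm ?mulr_ge0 ?exprn_ge0//.
  apply: le_lt_trans; apply: abs_sum_nat_le => [|i /andP[mi _]].
    by rewrite mulr_ge0 ?exprn_ge0.
  by rewrite (le_trans (ha i))// ler_wpM2l// ler_wiXn2l// ltW.
move=> m n Nm Nn; case/orP: (leq_total m n) => mn; last by rewrite tail ?Nn.
by rewrite abs_subC tail ?Nm.
Qed.

End NonarchimedeanAbsoluteValue.

(** * The exponential and the logarithm *)

(** Reindexing of the triangle i + j < n, by antidiagonals on the left and by
rows on the right: the truncated Cauchy product of two series. *)
Lemma sum_antidiagonal (V : nmodType) (f : nat -> nat -> V) n :
  \sum_(0 <= k < n) \sum_(0 <= i < k.+1) f i (k - i)%N =
  \sum_(0 <= i < n) \sum_(0 <= j < n - i) f i j.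
Proof.
elim: n => [|n IH]; first by rewrite !big_nil.
rewrite big_nat_recr//= IH [RHS]big_nat_recr//= subSnn big_nat1.
rewrite [in LHS](big_nat_recr n)//= subnn addrA -big_split/=; congr (_ + _).
apply: eq_big_nat => i /andP[_ ilt]; rewrite subSn ?(ltnW ilt)//.
by rewrite big_nat_recr.
Qed.

(** The upper bound M is independent of N so that the expansion can be compared
termwise with an arbitrarily long partial sum of a power series. *)
Lemma exprD1_sub1 (K : comPzRingType) (t : K) N M : (N <= M)%N ->
  (1 + t) ^+ N - 1 = \sum_(0 <= k < M) 'C(N, k.+1)%:R * t ^+ k.+1.
Proof.
move=> NM; rewrite (big_cat_nat (n := N))//= [X in _ = _ + X]big1_seq ?addr0.
  rewrite exprDn big_ord_recl /= expr1n mul1r expr0 bin0 mulr1n addrC addKr.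
  rewrite big_mkord; apply: eq_bigr => i _.
  by rewrite expr1n mul1r mulr_natl.
move=> k; rewrite mem_index_iota => /andP[_ /andP[Nk _]].
by rewrite bin_small ?mul0r.
Qed.

(** The hypothesis [abs_fact_ge] is what makes the discs of radius rho suitable:
there the general terms x^k/k! and t^k/k decay like (|x|/rho)^k and
(|t|/rho)^k. *)
Section ExpLog.
Import numFieldNormedType.Exports.
Local Open Scope classical_set_scope.
Local Open Scope ring_scope.

Variables (R : realType) (K : fieldType) (v : K -> R) (rho : R).
Hypothesis hv : is_nonarch_abs v.
Hypothesis hcomplete : abs_complete v.
Hypothesis rho_gt0 : 0 < rho.
Hypothesis abs_fact_ge : forall m, rho ^+ m <= v m.+1`!%:R.
Hypothesis small_nat : exists2 p, (0 < p)%N & v p%:R < 1.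

Local Notation E := (padic_exp v).
Local Notation L := (padic_log v).
Local Notation abs_ge0 := (abs_ge0 hv).
Local Notation absM := (absM hv).
Local Notation abs_nat_le1 := (abs_nat_le1 hv).

Let rho_le1 : rho <= 1.
Proof.
by have := abs_fact_ge 1; rewrite expr1 => /le_trans; apply; exact: abs_nat_le1.
Qed.

Lemma abs_fact_gt0 m : 0 < v m`!%:R.
Proof.
case: m => [|m]; first by rewrite (abs1 hv).
by rewrite (lt_le_trans _ (abs_fact_ge m))// exprn_gt0.
Qed.

Lemma abs_fact_le_nat m : v m.+1`!%:R <= v m.+1%:R.
Proof. by rewrite factS natrM absM ler_piMr ?abs_ge0 ?abs_nat_le1. Qed.

Lemma natr_neq0 n : (0 < n)%N -> n%:R != 0 :> K.
Proof.
case: n => // n _; rewrite -(abs_gt0 hv).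
by rewrite (lt_le_trans (abs_fact_gt0 n.+1))// abs_fact_le_nat.
Qed.

Lemma fact_neq0 n : n`!%:R != 0 :> K.
Proof. by rewrite natr_neq0 ?fact_gt0. Qed.

(** Both c = (m+1)! and c = m+1 qualify, which treats the series of exp and log
at the same time. *)
Lemma abs_monomial_le (x c : K) m : v m.+1`!%:R <= v c ->
  v (x ^+ m.+1 / c) <= v x * (v x / rho) ^+ m.
Proof.
move=> hc; have c0 := lt_le_trans (abs_fact_gt0 _) hc.
rewrite (abs_div hv) (absX hv) exprS -mulrA ler_wpM2l ?abs_ge0// expr_div_n.
rewrite ler_wpM2l ?exprn_ge0 ?abs_ge0// lef_pV2 ?posrE ?exprn_gt0//.
by rewrite (le_trans (abs_fact_ge m)).
Qed.

Let ratio_lt1 (x : K) : v x < rho -> 0 <= v x / rho < 1.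
Proof. by move=> hx; rewrite divr_ge0 ?abs_ge0 ?(ltW rho_gt0)//= ltr_pdivrMr// mul1r. Qed.

Let le_ratio (x : K) : v x <= v x / rho.
Proof. by rewrite ler_pdivlMr// ler_piMr ?abs_ge0. Qed.

Lemma abs_exp_term_le (x : K) k : v (x ^+ k / k`!%:R) <= (v x / rho) ^+ k.
Proof.
case: k => [|k]; first by rewrite !expr0 divr1 (abs1 hv).
rewrite (le_trans (abs_monomial_le _ (lexx _)))// exprS ler_wpM2r//.
by rewrite exprn_ge0// divr_ge0 ?abs_ge0 ?(ltW rho_gt0).
Qed.

Lemma abs_log_term_le (t : K) k :
  v ((-1) ^+ k * t ^+ k.+1 / k.+1%:R) <= v t * (v t / rho) ^+ k.
Proof. by rewrite -mulrA absM (abs_sign hv) mul1r abs_monomial_le// abs_fact_le_nat. Qed.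

Lemma padic_exp_cvg x : v x < rho ->
  abs_cvg v (series (fun k => x ^+ k / k`!%:R)) (E x).
Proof.
move=> hx; apply: (abs_series_cvg hv hcomplete ler01 (ratio_lt1 hx)) => k.
by rewrite mul1r abs_exp_term_le.
Qed.

Lemma padic_log_cvg q : v (q - 1) < rho ->
  abs_cvg v (series (fun k => (-1) ^+ k * (q - 1) ^+ k.+1 / k.+1%:R)) (L q).
Proof.
move=> hq; have c0 := abs_ge0 (q - 1).
apply: (abs_series_cvg hv hcomplete c0 (ratio_lt1 hq)) => k.
exact: abs_log_term_le.
Qed.

Lemma monomial_tail_le (x : K) k : v x < rho ->
  v x * (v x / rho) ^+ k.+1 <= v x * (v x / rho).
Proof.
move=> /ratio_lt1/andP[d0 d1]; rewrite ler_wpM2l ?abs_ge0// exprS ler_piMr//.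
by rewrite exprn_ile1// ltW.
Qed.

Let quad_ge0 (x : K) : 0 <= v x * (v x / rho).
Proof. by rewrite !mulr_ge0 ?abs_ge0 ?invr_ge0 ?ltW. Qed.

Lemma padic_exp_approx x : v x < rho -> v (E x - (1 + x)) <= v x * (v x / rho).
Proof.
move=> hx; apply: (abs_cvg_dist_le hv (padic_exp_cvg hx) (m := 2)) => // n n2.
rewrite /series/= (big_cat_nat (n := 2))//= 2?big_nat_recl//= big_nil.
rewrite expr0 expr1 !divr1 addr0 [X in v X]addrAC subrr add0r.
apply: abs_sum_nat_le => // -[|[|k]]// _.
by rewrite (le_trans (abs_monomial_le _ (lexx _)))// monomial_tail_le.
Qed.

Lemma padic_log_approx q : v (q - 1) < rho ->
  v (L q - (q - 1)) <= v (q - 1) * (v (q - 1) / rho).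
Proof.
move=> hq; apply: (abs_cvg_dist_le hv (padic_log_cvg hq) (m := 1)) => // n n1.
rewrite /series/= (big_cat_nat (n := 1))//= big_nat1.
rewrite expr0 expr1 !divr1 mul1r [X in v X]addrAC subrr add0r.
apply: abs_sum_nat_le => // -[|k]// _.
by rewrite (le_trans (abs_log_term_le _ _))// monomial_tail_le.
Qed.

Let quad_le (x : K) : v x < rho -> v x * (v x / rho) <= v x.
Proof. by move=> /ratio_lt1/andP[_ d1]; rewrite ler_piMr ?abs_ge0// ltW. Qed.

Lemma abs_padic_log_le q : v (q - 1) < rho -> v (L q) <= v (q - 1).
Proof.
move=> hq; rewrite -(subrK (q - 1) (L q)); apply: abs_leD => //.
by rewrite (le_trans (padic_log_approx hq))// quad_le.
Qed.

Lemma abs_padic_exp_sub1 x : v x < rho -> v (E x - 1) <= v x.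
Proof.
move=> hx; rewrite -(subrK x (E x - 1)); apply: abs_leD => //.
by rewrite -addrA -opprD (le_trans (padic_exp_approx hx))// quad_le.
Qed.

(** If q <> 1, the linear term q - 1 of the series strictly dominates the rest. *)
Lemma padic_log_eq0 q : v (q - 1) < rho -> L q = 0 -> q = 1.
Proof.
move=> hq Lq; apply/eqP; rewrite -subr_eq0 -(abs_eq0 hv).
have := padic_log_approx hq; rewrite Lq sub0r (absN hv).
have /andP[_ d1] := ratio_lt1 hq.
apply: contraTT => t0.
by rewrite -ltNge gtr_pMr// lt_def abs_ge0 andbT.
Qed.

(** The truncated product of the two series differs from the truncated series
at x + y by the terms x^i/i! y^j/j! with i, j < n <= i + j, all of absolute
value at most d^n, where d < 1. *)
Lemma padic_expD x y : v x < rho -> v y < rho -> E (x + y) = E x * E y.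
Proof.
move=> hx hy; have hxy : v (x + y) < rho by exact: (abs_ltD hv).
set d := Num.max (v x / rho) (v y / rho).
have d01 : 0 <= d < 1.
  rewrite le_max gt_max; have /andP[-> ->] := ratio_lt1 hx.
  by have /andP[_ ->] := ratio_lt1 hy.
have /andP[d0 d1] := d01.
apply: (abs_cvg_unique hv (padic_exp_cvg hxy)).
have cxy := abs_cvgM hv (padic_exp_cvg hx) (padic_exp_cvg hy).
apply: (abs_cvg_close hv cxy (B := fun n => d ^+ n)).
  by apply: cvg_expr; rewrite ger0_norm.
move=> n; rewrite (abs_subC hv) /series/=.
pose f i j : K := (x ^+ i / i`!%:R) * (y ^+ j / j`!%:R).
have -> : \sum_(0 <= k < n) (x + y) ^+ k / k`!%:R =
    \sum_(0 <= i < n) \sum_(0 <= j < n - i) f i j.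
  rewrite -sum_antidiagonal; apply: eq_bigr => k _.
  rewrite exprDn -(big_mkord xpredT (fun i => x ^+ (k - i) * y ^+ i *+ 'C(k, i))).
  rewrite big_nat_rev/= mulr_suml; apply: eq_big_nat => i /andP[_ ik].
  have {}ik : (i <= k)%N by [].
  rewrite add0n subSS subKn// bin_sub// /f -(bin_fact ik) !natrM -mulr_natr.
  have := @natr_neq0 'C(k, i); rewrite bin_gt0 => /(_ ik) ?.
  have ? := fact_neq0 i; have ? := fact_neq0 (k - i)%N.
  by field; apply/and3P.
rewrite mulr_suml -sumrB; apply: (abs_sum_nat_le hv); first by rewrite exprn_ge0.
move=> i /andP[_ ilt]; rewrite mulr_sumr.
rewrite (big_cat_nat (n := (n - i)%N))//= ?leq_subr// [X in v X]addrAC subrr add0r.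
apply: (abs_sum_nat_le hv) => [|j /andP[hj _]]; first by rewrite exprn_ge0.
have nij : (n <= i + j)%N by rewrite leq_subLR in hj.
have xi := abs_exp_term_le x i; have yj := abs_exp_term_le y j.
rewrite absM (le_trans (ler_pM _ _ xi yj)) ?abs_ge0//.
have le_d (z : K) k : v z < rho -> v z / rho <= d -> (v z / rho) ^+ k <= d ^+ k.
  by move=> /ratio_lt1/andP[z0 _] zd; rewrite lerXn2r ?nnegrE.
have /andP[x0 _] := ratio_lt1 hx; have /andP[y0 _] := ratio_lt1 hy.
have xd : (v x / rho) ^+ i <= d ^+ i by rewrite le_d// le_max lexx.
have yd : (v y / rho) ^+ j <= d ^+ j by rewrite le_d// le_max lexx orbT.
rewrite (le_trans (ler_pM _ _ xd yd)) ?exprn_ge0// -exprD.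
by rewrite ler_wiXn2l// ltW.
Qed.

Lemma abs_natM_lt n (x : K) : v x < rho -> v (n%:R * x) < rho.
Proof. by apply: le_lt_trans; rewrite absM ler_piMl ?abs_ge0 ?abs_nat_le1. Qed.

Lemma padic_exp0 : E 0 = 1.
Proof.
apply/eqP; rewrite -subr_eq0 -(abs_eq0 hv) eq_le abs_ge0 andbT.
by have := @abs_padic_exp_sub1 0; rewrite (abs0 hv); apply.
Qed.

Lemma padic_exp_natM n x : v x < rho -> E (n%:R * x) = E x ^+ n.
Proof.
move=> hx; elim: n => [|n IH]; first by rewrite mul0r padic_exp0.
by rewrite -natr1 mulrDl mul1r padic_expD ?abs_natM_lt// IH exprSr.
Qed.

(** This is the congruence (n-1)(n-2)...(n-m) = (-1)^m m! modulo n for n = N+1,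
as an estimate: integers have absolute value at most 1.  It also holds for
m > N, where the falling factorial vanishes. *)
Lemma ffact_approx N m :
  v ((N ^_ m)%:R - (-1) ^+ m * m`!%:R) <= v N.+1%:R.
Proof.
elim: m => [|m IH]; first by rewrite ffactn0 fact0 expr0 mulr1 subrr (abs0 hv) abs_ge0.
have -> : (N ^_ m.+1)%:R - (-1) ^+ m.+1 * m.+1`!%:R =
    ((N ^_ m)%:R - (-1) ^+ m * m`!%:R) * (N.+1%:R - m.+1%:R) +
    (-1) ^+ m * m`!%:R * N.+1%:R :> K.
  have -> : (N ^_ m.+1)%:R = (N ^_ m)%:R * (N.+1%:R - m.+1%:R) :> K.
    have [mN|Nm] := leqP m N; last by rewrite !ffact_small ?mul0r // ltnS ltnW.
    by rewrite ffactnSr natrM -natrB ?subSS.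
  by rewrite factS natrM exprS; ring.
apply: (abs_leD hv); rewrite absM.
  rewrite (le_trans _ IH)// ler_piMr ?abs_ge0//.
  by apply: (abs_leB hv); exact: abs_nat_le1.
by rewrite ler_piMl ?abs_ge0// absM (abs_sign hv) mul1r abs_nat_le1.
Qed.

(** The logarithm is the derivative at 0 of N |-> q^N.  After division by N, the
coefficient of (q-1)^(k+1) in q^N - 1 is (N-1)...(N-k)/(k+1)!, and that of the
logarithm is (-1)^k k!/(k+1)!; their numerators agree modulo N. *)
Lemma pow_log_approx N q : (0 < N)%N -> v (q - 1) < rho ->
  v (L q - (q ^+ N - 1) / N%:R) <= v N%:R * v (q - 1).
Proof.
case: N => // N _ hq; have N0 : N.+1%:R != 0 :> K by rewrite natr_neq0.
have bnd0 : 0 <= v N.+1%:R * v (q - 1) by rewrite mulr_ge0 ?abs_ge0.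
apply: (abs_cvg_dist_le hv (padic_log_cvg hq) (m := N.+1)) => // M NM.
rewrite -{2}(subrKC 1 q) (exprD1_sub1 _ NM) /series/= mulr_suml -sumrB.
apply: (abs_sum_nat_le hv) => // k _; set t := q - 1.
have -> : (-1) ^+ k * t ^+ k.+1 / k.+1%:R -
      'C(N.+1, k.+1)%:R * t ^+ k.+1 / N.+1%:R =
    - (((N ^_ k)%:R - (-1) ^+ k * k`!%:R) * (t ^+ k.+1 / k.+1`!%:R)).
  have /(congr1 (fun n => n%:R : K)) := bin_ffact N.+1 k.+1.
  rewrite ffactSS [LHS]natrM [RHS]natrM => C.
  have k0 : k.+1%:R != 0 :> K by rewrite natr_neq0.
  have kf0 := fact_neq0 k; have kf1 := fact_neq0 k.+1.
  have -> : 'C(N.+1, k.+1)%:R = N.+1%:R * (N ^_ k)%:R / k.+1`!%:R :> K.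
    by rewrite -C mulfK.
  rewrite factS natrM.
  move: N0 k0 kf0.
  move: (N.+1%:R : K) (k.+1%:R : K) (k`!%:R : K) => a b c a0 b0 c0.
  by field; rewrite a0 b0 c0.
rewrite (absN hv) absM ler_pM ?abs_ge0 ?ffact_approx//.
rewrite (le_trans (abs_monomial_le _ (lexx _)))// ler_piMr ?abs_ge0//.
by have /andP[d0 d1] := ratio_lt1 hq; rewrite exprn_ile1// ltW.
Qed.

(** Along the powers N of an integer of absolute value less than 1, the bounds
in the hypothesis and in [pow_log_approx] tend to 0. *)
Lemma padic_log_unique q y : v (q - 1) < rho ->
  (forall N, (0 < N)%N -> v (y - (q ^+ N - 1) / N%:R) <= v N%:R) -> L q = y.
Proof.
move=> hq hy; have [p p0 p1] := small_nat.
apply/eqP; rewrite -subr_eq0 -(abs_eq0 hv) eq_le abs_ge0 andbT.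
apply/ler_addgt0Pr => e e0; rewrite add0r.
have : (fun k => v p%:R ^+ k) @ \oo --> (0 : R).
  by apply: cvg_expr; rewrite ger0_norm ?abs_ge0.
move=> /cvgr0Pnorm_lt/(_ _ e0)[k _ /(_ k (leqnn k))].
rewrite /= ger0_norm ?exprn_ge0 ?abs_ge0// -(absX hv) -natrX => /ltW ple.
have N0 : (0 < p ^ k)%N by rewrite expn_gt0 p0.
apply: le_trans ple; rewrite -(subrKA ((q ^+ (p ^ k) - 1) / (p ^ k)%:R)).
apply: (abs_leD hv); last by rewrite (abs_subC hv) hy.
rewrite (le_trans (pow_log_approx N0 hq))// ler_piMr ?abs_ge0//.
by rewrite (le_trans (ltW hq)).
Qed.

Let abs_unit q : v (q - 1) < rho -> v q = 1.
Proof.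
move=> hq; have q1 : v (q - 1) < 1 by rewrite (lt_le_trans hq).
apply/eqP; rewrite eq_le; apply/andP; split.
  by rewrite -(subrK 1 q); apply: (abs_leD hv); rewrite ?(ltW q1) ?(abs1 hv).
rewrite leNgt; apply/negP => vq.
have : v 1 < 1; last by rewrite (abs1 hv) ltxx.
by rewrite -[X in v X](subrK q 1); apply: (abs_ltD hv); rewrite ?(abs_subC hv 1).
Qed.

Lemma abs_mul_sub1_lt a b :
  v (a - 1) < rho -> v (b - 1) < rho -> v (a * b - 1) < rho.
Proof.
move=> ha hb; have -> : a * b - 1 = a * (b - 1) + (a - 1) by ring.
by apply: (abs_ltD hv) => //; rewrite absM (abs_unit ha) mul1r.
Qed.

Lemma abs_pow_sub1_lt q n : v (q - 1) < rho -> v (q ^+ n - 1) < rho.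
Proof.
move=> hq; elim: n => [|n IH]; first by rewrite subrr (abs0 hv).
by rewrite exprS abs_mul_sub1_lt.
Qed.

(** With A = (a^N-1)/N and B = (b^N-1)/N one has ((ab)^N-1)/N = A + B + N A B,
and |A|, |B| <= 1. *)
Lemma padic_logM a b :
  v (a - 1) < rho -> v (b - 1) < rho -> L (a * b) = L a + L b.
Proof.
move=> ha hb; apply: padic_log_unique => [|N N0]; first exact: abs_mul_sub1_lt.
have Nn0 : N%:R != 0 :> K by rewrite natr_neq0.
have approx c : v (c - 1) < rho ->
    v (L c - (c ^+ N - 1) / N%:R) <= v N%:R /\ v ((c ^+ N - 1) / N%:R) <= 1.
  move=> hc; have c1 : v (c - 1) <= 1 by rewrite (le_trans (ltW hc)).
  have approxc : v (L c - (c ^+ N - 1) / N%:R) <= v N%:R.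
    by rewrite (le_trans (pow_log_approx N0 hc))// ler_piMr ?abs_ge0.
  split=> //; rewrite -(subKr (L c) ((c ^+ N - 1) / N%:R)); apply: (abs_leB hv).
    by rewrite (le_trans (abs_padic_log_le hc)).
  exact: le_trans approxc (abs_nat_le1 N).
have [{}ha a1] := approx _ ha; have [{}hb b1] := approx _ hb.
set A := (a ^+ N - 1) / N%:R in ha a1; set B := (b ^+ N - 1) / N%:R in hb b1.
have -> : L a + L b - ((a * b) ^+ N - 1) / N%:R =
    (L a - A) + (L b - B) - N%:R * A * B by rewrite exprMn /A /B; field.
apply: (abs_leB hv); first exact: (abs_leD hv).
by rewrite -mulrA absM ler_piMr ?abs_ge0// absM mulr_ile1 ?abs_ge0.
Qed.

(** Since exp x ^ N = exp (N x), the quotient (exp x ^ N - 1)/N differs from x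
by the terms of degree at least 2 of exp (N x), divided by N. *)
Lemma padic_expK x : v x < rho -> L (E x) = x.
Proof.
move=> hx; apply: padic_log_unique => [|N N0].
  exact: le_lt_trans (abs_padic_exp_sub1 hx) hx.
have Nn0 : N%:R != 0 :> K by rewrite natr_neq0.
rewrite -padic_exp_natM//.
have -> : x - (E (N%:R * x) - 1) / N%:R =
    - (E (N%:R * x) - (1 + N%:R * x)) / N%:R by field.
rewrite (abs_div hv) (absN hv) ler_pdivrMr ?(abs_gt0 hv)//.
rewrite (le_trans (padic_exp_approx (abs_natM_lt N hx)))// absM.
rewrite -[X in _ * X]mulrA mulrACA ler_piMr ?mulr_ge0 ?abs_ge0//.
by rewrite (le_trans (quad_le hx))// (le_trans (ltW hx)).
Qed.

Lemma padic_log1 : L 1 = 0.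
Proof. by rewrite -padic_exp0 padic_expK ?(abs0 hv). Qed.

Lemma padic_logX q n : v (q - 1) < rho -> L (q ^+ n) = n%:R * L q.
Proof.
move=> hq; elim: n => [|n IH]; first by rewrite padic_log1 mul0r.
by rewrite exprS padic_logM ?abs_pow_sub1_lt// IH -nat1r mulrDl mul1r.
Qed.

Lemma padic_log_inj a b :
  v (a - 1) < rho -> v (b - 1) < rho -> L a = L b -> a = b.
Proof.
move=> ha hb Lab; have vb := abs_unit hb.
have b0 : b != 0 by rewrite -(abs_gt0 hv) vb.
have hab : v (a / b - 1) < rho.
  have -> : a / b - 1 = ((a - 1) - (b - 1)) / b by field.
  by rewrite (abs_div hv) vb divr1; apply: (abs_ltD hv); rewrite ?(absN hv).
apply: (divIf b0); rewrite divff//; apply: padic_log_eq0 => //.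
by apply: (addIr (L b)); rewrite add0r -padic_logM// divfK.
Qed.

(** Both sides have the same logarithm. *)
Lemma padic_logK q : v (q - 1) < rho -> E (L q) = q.
Proof.
move=> hq; have hL := le_lt_trans (abs_padic_log_le hq) hq.
apply: padic_log_inj => //; last by rewrite padic_expK.
exact: le_lt_trans (abs_padic_exp_sub1 hL) hL.
Qed.

(** The disc |q - 1| < rho contains no nontrivial root of unity, as log q^n is
n log q. *)
Lemma pow_neq1 q n : v (q - 1) < rho -> q != 1 -> (0 < n)%N -> q ^+ n != 1.
Proof.
move=> hq q1 n0; apply: contraNneq q1 => qn.
apply/eqP/padic_log_eq0 => //; apply: (mulfI (natr_neq0 n0)).
by rewrite mulr0 -padic_logX// qn padic_log1.
Qed.

End ExpLog.

(** * The absolute value of C_p on the integers *)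

(** Legendre's formula; the floors telescope because
(p-1) (m/p^(k+1)) + m/p^(k+1) <= m/p^k.  Carrying a maximum with 1 along the
induction gives the bound m for (m+1)! instead of m + 1. *)
Lemma logn_fact_le p m : prime p -> (p.-1 * logn p m.+1`! <= m)%N.
Proof.
move=> hp; rewrite logn_fact//.
have step k : (p.-1 * (\sum_(1 <= i < k.+1) m.+1 %/ p ^ i) +
               maxn 1 (m.+1 %/ p ^ k) <= m.+1)%N.
  elim: k => [|k IH]; first by rewrite big_geq// muln0 expn0 divn1 (maxn_idPr _).
  rewrite big_nat_recr//= mulnDr; apply: leq_trans IH.
  rewrite -addnA leq_add2l expnSr divnMA.
  have [->|d0] := posnP (m.+1 %/ p ^ k %/ p)%N.
    by rewrite muln0 add0n leq_maxl.
  rewrite (maxn_idPr d0) -mulSnr prednK ?prime_gt0// mulnC.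
  by rewrite (leq_trans (leq_trunc_div _ _))// leq_maxr.
rewrite -ltnS -addn1; apply: leq_trans (step m.+1).
by rewrite leq_add2l leq_maxl.
Qed.

Lemma padic_radiusX (R : realType) p : prime p ->
  padic_radius R p ^+ p.-1 = p%:R^-1.
Proof.
move=> hp; have p0 : 0 < p%:R :> R by rewrite ltr0n prime_gt0.
rewrite -powR_mulrn ?powR_ge0// /padic_radius -powRrM -subn1 natrB ?prime_gt0//.
have p1 : p%:R - 1 != 0 :> R by rewrite subr_eq0 pnatr_eq1 gtn_eqF ?prime_gt1.
by rewrite mulNr mulVf// powR_inv1 ?ltW.
Qed.

Lemma padic_radius_gt0 (R : realType) p : prime p -> 0 < padic_radius R p.
Proof. by move=> hp; rewrite powR_gt0// ltr0n prime_gt0. Qed.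

Lemma padic_radius_le1 (R : realType) p : prime p -> padic_radius R p <= 1.
Proof.
move=> hp; have p0 : (0 < p.-1)%N by rewrite -subn1 subn_gt0 prime_gt1.
rewrite -(expr_le1 p0) ?padic_radiusX//; last by rewrite ltW// padic_radius_gt0.
by rewrite invf_le1 ?ltr0n ?ler1n prime_gt0.
Qed.

Lemma is_Cp_abs_natr (R : realType) p (C : fieldType) (v : C -> R) n :
  is_Cp p v -> (0 < n)%N -> v n%:R = p%:R^-1 ^+ logn p n.
Proof.
case=> Qp [vp [i [Qpbar [vbar [j [k]]]]]] [[_ vi _ _] _ _ vj [_ vk _ _]] n0.
have -> : n%:R = k (j (i n%:R)) by rewrite !rmorph_nat.
rewrite vk vj vi /padic_abs_rat pnatr_eq0 gtn_eqF// (pmulrn (1 : rat)) numq_int denq_int.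
by rewrite /= logn1 sub0r exprVn exprnN.
Qed.

Lemma is_Cp_abs_fact_ge (R : realType) p (C : fieldType) (v : C -> R) m :
  prime p -> is_Cp p v -> padic_radius R p ^+ m <= v m.+1`!%:R.
Proof.
move=> hp hC; rewrite (is_Cp_abs_natr hC) ?fact_gt0// -padic_radiusX// -exprM.
by rewrite ler_wiXn2l ?logn_fact_le ?padic_radius_le1// ltW// padic_radius_gt0.
Qed.

Lemma is_Cp_abs_p (R : realType) p (C : fieldType) (v : C -> R) :
  prime p -> is_Cp p v -> v p%:R < 1.
Proof.
move=> hp hC; rewrite (is_Cp_abs_natr hC) ?prime_gt0// logn_prime// eqxx expr1.
by rewrite invf_lt1 ?ltr0n ?prime_gt0// ltr1n prime_gt1.
Qed.

(** * Carlitz-Bernoulli sums *)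

Lemma sum_ffun_expr (A : comPzSemiRingType) r w (z : A) :
  \sum_(j : {ffun 'I_r -> 'I_w}) z ^+ (\sum_(i < r) j i)%N =
  (\sum_(i < w) z ^+ i) ^+ r.
Proof.
rewrite -[r in RHS]card_ord -prodr_const bigA_distr_bigA/=.
by apply: eq_bigr => j _; rewrite expr_sum.
Qed.

Section CarlitzSum.
Variables (R : realType) (K : fieldType) (v : K -> R) (rho : R).
Hypothesis hv : is_nonarch_abs v.
Hypothesis hcomplete : abs_complete v.
Hypothesis rho_gt0 : 0 < rho.
Hypothesis abs_fact_ge : forall m, rho ^+ m <= v m.+1`!%:R.
Hypothesis small_nat : exists2 p, (0 < p)%N & v p%:R < 1.
Variable q : K.
Hypothesis q_near1 : v (q - 1) < rho.

Local Notation E := (padic_exp v).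
Local Notation L := (padic_log v).

Lemma padic_pow_powl w z : padic_pow v (q ^+ w) z = E (z * (w%:R * L q)).
Proof. by rewrite /padic_pow (padic_logX hv hcomplete rho_gt0). Qed.

Lemma abs_log_lt : v (L q) < rho.
Proof.
apply: le_lt_trans q_near1.
exact: (abs_padic_log_le hv hcomplete rho_gt0 abs_fact_ge).
Qed.

Lemma padic_exp_natM_log m : E (m%:R * L q) = q ^+ m.
Proof.
rewrite (padic_exp_natM hv hcomplete rho_gt0) ?abs_log_lt//.
by rewrite (padic_logK hv hcomplete rho_gt0).
Qed.

Lemma qbracket_powl w m :
  qbracket v (q ^+ w) m%:R = (1 - q ^+ (w * m)) / (1 - q ^+ w).
Proof.
by rewrite /qbracket padic_pow_powl mulrA -natrM padic_exp_natM_log mulnC.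
Qed.

Hypothesis q_neq1 : q != 1.

(** The right-hand side is visibly symmetric in w1 and w2. *)
Lemma qbracket_sum_carlitz n r w1 w2 x :
  (0 < w1)%N -> (0 < w2)%N -> v x <= 1 ->
  qbracket v q w1%:R ^ (n%:Z - r%:Z) *
    (\sum_(j : {ffun 'I_r -> 'I_w1})
       q ^+ (w2 * \sum_(i < r) j i)%N *
       carlitz_bernoulli v r n (q ^+ w1)
         (w2%:R * x + w2%:R / w1%:R * (\sum_(i < r) j i)%N%:R)) =
  (1 - q) ^+ r / (1 - q) ^+ n *
  \sum_(0 <= l < n.+1)
     'C(n, l)%:R * (-1) ^+ l * E (l%:R * (w1 * w2)%:R * x * L q) *
     (l.+1%:R * (1 - q ^+ (w1 * w2 * l.+1)) /
      ((1 - q ^+ (w1 * l.+1)) * (1 - q ^+ (w2 * l.+1)))) ^+ r.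
Proof.
move=> w1_gt0 w2_gt0 hx.
have sub_neq0 m : (0 < m)%N -> 1 - q ^+ m != 0.
  move=> m0; rewrite subr_eq0 eq_sym.
  exact: (pow_neq1 hv hcomplete rho_gt0 abs_fact_ge small_nat q_near1).
have A0 : 1 - q != 0 by rewrite -[q]expr1 sub_neq0.
have B0 := sub_neq0 _ w1_gt0.
have w10 : w1%:R != 0 :> K by rewrite (natr_neq0 hv rho_gt0 abs_fact_ge).
have hxL : v (x * L q) < rho.
  by rewrite (absM hv) (le_lt_trans _ abs_log_lt)// ler_piMl ?(abs_ge0 hv).
(* The denominator w1 in the argument is absorbed by log (q^w1) = w1 log q. *)
have pow_split l S :
    padic_pow v (q ^+ w1) (l%:R * (w2%:R * x + w2%:R / w1%:R * S%:R)) =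
    E (l%:R * (w1 * w2)%:R * x * L q) * q ^+ (w2 * l * S).
  rewrite padic_pow_powl -padic_exp_natM_log.
  rewrite -(padic_expD hv hcomplete rho_gt0 abs_fact_ge).
  - by congr (E _); rewrite !natrM; field.
  - by rewrite -mulrA -natrM (abs_natM_lt hv).
  - by rewrite (abs_natM_lt hv)// abs_log_lt.
have -> : qbracket v q w1%:R = (1 - q ^+ w1) / (1 - q).
  by have := qbracket_powl 1 w1; rewrite expr1 mul1n.
have brk0 : (1 - q ^+ w1) / (1 - q) != 0 by rewrite mulf_neq0 ?invr_neq0.
rewrite expfzDr// -exprnN -exprnP.
rewrite /carlitz_bernoulli.
under eq_bigr => j _.
  rewrite mulrCA mulr_sumr.
  under eq_bigr => l _ do rewrite pow_split qbracket_powl.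
  over.
rewrite -mulr_sumr exchange_big/= !mulr_sumr; apply: eq_bigr => l _.
set D := 1 - q ^+ (w1 * l.+1); set F := 1 - q ^+ (w2 * l.+1).
set e := E _; set c := 'C(n, l)%:R * (-1) ^+ l.
have D0 : D != 0 by rewrite sub_neq0// muln_gt0 w1_gt0.
have F0 : F != 0 by rewrite sub_neq0// muln_gt0 w2_gt0.
have geo : \sum_(i < w1) (q ^+ (w2 * l.+1)) ^+ i = (1 - q ^+ (w1 * w2 * l.+1)) / F.
  apply: (mulfI F0); rewrite [RHS]mulrC divfK//.
  rewrite /F -(opprB _ 1) mulNr -subrX1 opprB -exprM.
  by congr (1 - q ^+ _); lia.
transitivity (((1 - q ^+ w1) / (1 - q)) ^+ n /
                ((1 - q ^+ w1) / (1 - q)) ^+ r *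
   (((1 - q ^+ w1) ^+ n)^-1 * (c * e * (l.+1%:R / (D / (1 - q ^+ w1))) ^+ r *
    ((1 - q ^+ (w1 * w2 * l.+1)) / F) ^+ r))).
  congr (_ * (_ * _)); rewrite -geo -sum_ffun_expr mulr_sumr.
  apply: eq_bigr => j _; rewrite -exprM.
  have -> : (w2 * l.+1 * (\sum_(i < r) j i) =
             w2 * (\sum_(i < r) j i) + w2 * l * (\sum_(i < r) j i))%N by lia.
  by rewrite exprD; ring.
set G := 1 - q ^+ (w1 * w2 * l.+1); set B := 1 - q ^+ w1.
rewrite !(expr_div_n, exprMn).
have An := expf_neq0 n A0; have Ar := expf_neq0 r A0.
have Bn := expf_neq0 n B0; have Br := expf_neq0 r B0.
have Dr := expf_neq0 r D0; have Fr := expf_neq0 r F0.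
by field; rewrite An Ar Bn Br Dr Fr.
Qed.

End CarlitzSum.

Theorem theorem3 (R : realType) (p : nat) (hp : prime p)
    (C : fieldType) (v : C -> R) (hC : is_Cp p v)
    (n r w1 w2 : nat) (hr : (0 < r)%N) (hw1 : (0 < w1)%N) (hw2 : (0 < w2)%N)
    (q : C) (hq1 : q != 1) (hq : v (1 - q) < padic_radius R p)
    (x : C) (hx : v x <= 1) :
  qbracket v q w1%:R ^ (n%:Z - r%:Z) *
    (\sum_(j : {ffun 'I_r -> 'I_w1})
       q ^+ (w2 * \sum_(i < r) j i)%N *
       carlitz_bernoulli v r n (q ^+ w1)
         (w2%:R * x + w2%:R / w1%:R * (\sum_(i < r) j i)%N%:R))
  = qbracket v q w2%:R ^ (n%:Z - r%:Z) *
    (\sum_(j : {ffun 'I_r -> 'I_w2})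
       q ^+ (w1 * \sum_(i < r) j i)%N *
       carlitz_bernoulli v r n (q ^+ w2)
         (w1%:R * x + w1%:R / w2%:R * (\sum_(i < r) j i)%N%:R)).
Proof.
have [_ [_ [_ [_ [_ [_ [_ [_ _ _ _ [hv _ _ hcomplete]]]]]]]]] := hC.
have hq' : v (q - 1) < padic_radius R p by rewrite (abs_subC hv).
have small_nat : exists2 m, (0 < m)%N & v m%:R < 1.
  by exists p; [exact: prime_gt0|exact: is_Cp_abs_p hp hC].
have sym := qbracket_sum_carlitz hv hcomplete (padic_radius_gt0 R hp)
  (fun m => is_Cp_abs_fact_ge m hp hC) small_nat hq' hq1 n r _ _ hx.
rewrite sym// sym//; congr (_ * _); apply: eq_bigr => l _.
by rewrite (mulnC w2 w1) [(1 - q ^+ (w2 * _)) * _]mulrC.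
Qed.
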